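(* Let $\mathbf c$ be a smooth bi-regular closed curve in $\mathbb R^3$, parametrized by arc length $s\in[0,L]$, with Frenet frame $\{\mathbf t,\mathbf n,\mathbf b\}$, curvature $\kappa(s)>0$ and torsion $\tau(s)$. Let $r(s)>0$ and $\theta(s)\in\,]0,\pi[$ be smooth $L$-periodic functions and let $\alpha:\mathbb S^1\times\mathbb S^1\to\mathbb R^3$ be the smooth immersion defined on $\mathbb R^2$ modulo $L\times2\pi$ by $$\alpha(s,\varphi)=\mathbf c(s)+r(s)\cos\theta(s)\,\mathbf t(s)+r(s)\sin\theta(s)\,[\cos\varphi\,\mathbf n(s)+\sin\varphi\,\mathbf b(s)].$$ Assume that for all $s$: $\cos\theta(s)=-r'(s)$ (with $r'(s)<1$), $$\kappa(s)<\frac{1-r'(s)^2-r(s)r''(s)}{r(s)\sqrt{1-r'(s)^2}},$$ and also $$\kappa(s)<\left|\frac{1-r'(s)^2-2r(s)r''(s)}{2r(s)\sqrt{1-r'(s)^2}}\right|.$$ Then: (1) The maximal principal curvature lines of $\alpha$ are the circles tangent to $\partial/\partial\varphi$ (that is, $s=$ constant), and the maximal principal curvature is $k_2(s)=1/r(s)$. (2) The minimal principal curvature lines of $\alpha$ are the curves tangent to $$V(s,\varphi)=\frac{\partial}{\partial s}-\left(\tau(s)+\frac{r'(s)}{(1-r'(s)^2)^{1/2}}\,\kappa(s)\sin\varphi\right)\frac{\partial}{\partial\varphi}.$$ (3) The expression $$r(s)(1-r'(s)^2)^{1/2}\kappa(s)\cos\varphi+r(s)r''(s)-(1-r'(s)^2)$$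 is negative, and the minimal principal curvature is given by $$k_1(s,\varphi)=\frac{\kappa(s)(1-r'(s)^2)^{1/2}\cos\varphi+r''(s)}{r(s)(1-r'(s)^2)^{1/2}\kappa(s)\cos\varphi+r(s)r''(s)-(1-r'(s)^2)}.$$ (4) There are no umbilic points for $\alpha$: $k_1(s,\varphi)<k_2(s)$ for all $(s,\varphi)$.
   Context: $\mathbb R^3$ carries its Euclidean inner product, norm $|\cdot|$ and canonical orientation, relative to which the wedge (cross) product $\wedge$ is defined. The closed curve $\mathbf c$ is smooth and $L$-periodic, with $\mathbf c'(s)=\mathbf t(s)$ and $|\mathbf t(s)|=1$; bi-regular means $\kappa(s)=|\mathbf t'(s)|>0$ for all $s$. The Frenet frame, with $\mathbf b=\mathbf t\wedge\mathbf n$, is the positive orthonormal frame satisfying $\mathbf t'=\kappa\mathbf n$, $\mathbf n'=-\kappa\mathbf t+\tau\mathbf b$, $\mathbf b'=-\tau\mathbf n$. The torus is oriented by the ordered frame $\{\partial/\partial s,\partial/\partial\varphi\}$, and the positive unit normal $N_\alpha$ is defined by $|\alpha_s\wedge\alpha_\varphi|\,N_\alpha=\alpha_s\wedge\alpha_\varphi$. Under the hypotheses, $N_\alpha=r'(s)\,\mathbf t(s)-(1-r'(s)^2)^{1/2}[\cos\varphi\,\mathbf n(s)+\sin\varphi\,\mathbf b(s)]$, which points inward. Principal directions and principal curvatures are taken with respect to $N_\alpha$, with the sign convention of Rodrigues' equation: a tangent vector $v\neq0$ is a principal direction with principal curvature $k$ if and only if $dN_\alpha(v)+k\,d\alpha(v)=0$.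 Principal curvature lines are the integral curves of the principal direction fields; they are maximal (resp. minimal) when they correspond to the larger (resp. smaller) principal curvature. An umbilic point is a point at which the two principal curvatures coincide. *)

(* Defs.v *)
(* Stdlib reals with Coquelicot. *)
From Stdlib Require Import Reals.
From Coquelicot Require Import Coquelicot.
Open Scope R_scope.

Definition E3 : Type := (R * R * R)%type.

Definition cx (p : E3) : R := fst (fst p).
Definition cy (p : E3) : R := snd (fst p).
Definition cz (p : E3) : R := snd p.

Definition dot (p q : E3) : R := cx p * cx q + cy p * cy q + cz p * cz q.
Definition enorm (p : E3) : R := sqrt (dot p p).
Definition cross (p q : E3) : E3 :=
  (cy p * cz q - cz p * cy q,
   cz p * cx q - cx p * cz q,
   cx p * cy q - cy p * cx q).

Definition smooth (f : R -> R) : Prop := forall n x, ex_derive_n f n x.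
Definition smooth3 (f : R -> E3) : Prop :=
  smooth (fun u => cx (f u)) /\ smooth (fun u => cy (f u)) /\
  smooth (fun u => cz (f u)).

Definition periodic {T : Type} (L : R) (f : R -> T) : Prop :=
  forall s, f (s + L) = f s.

Definition Derive3 (f : R -> E3) (u : R) : E3 :=
  (Derive (fun v => cx (f v)) u,
   Derive (fun v => cy (f v)) u,
   Derive (fun v => cz (f v)) u).

Record frenet_frame (c t n b : R -> E3) (kappa tau : R -> R) : Prop := {
  frenet_velocity : forall s, is_derive c s (t s);
  frenet_t_unit : forall s, enorm (t s) = 1;
  frenet_n_unit : forall s, enorm (n s) = 1;
  frenet_t_n : forall s, dot (t s) (n s) = 0;
  frenet_b : forall s, b s = cross (t s) (n s);
  frenet_kappa : forall s, kappa s = enorm (Derive3 t s);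
  frenet_dt : forall s, is_derive t s (scal (kappa s) (n s));
  frenet_dn : forall s,
    is_derive n s (plus (scal (- kappa s) (t s)) (scal (tau s) (b s)));
  frenet_db : forall s, is_derive b s (scal (- tau s) (n s)) }.

(* Maps defined on the torus R^2 / (L Z x 2 pi Z), and curves on it, are
   represented by their lifts to the universal cover R^2, with coordinates
   (s, phi); R * R is also used for tangent vectors, in the frame
   (d/ds, d/dphi). *)
Definition d_s (X : R -> R -> E3) (s phi : R) : E3 :=
  Derive3 (fun u => X u phi) s.
Definition d_phi (X : R -> R -> E3) (s phi : R) : E3 :=
  Derive3 (fun u => X s u) phi.
Definition differential (X : R -> R -> E3) (s phi : R) (v : R * R) : E3 :=
  plus (scal (fst v) (d_s X s phi)) (scal (snd v) (d_phi X s phi)).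

Definition immersion (X : R -> R -> E3) : Prop :=
  forall s phi v, differential X s phi v = zero -> v = zero.

Definition unit_normal (X : R -> R -> E3) (s phi : R) : E3 :=
  let w := cross (d_s X s phi) (d_phi X s phi) in scal (/ enorm w) w.

(* Rodrigues' equation dN(v) + k dX(v) = 0. *)
Definition principal_direction (X : R -> R -> E3) (s phi : R)
    (v : R * R) (k : R) : Prop :=
  v <> zero /\
  plus (differential (unit_normal X) s phi v)
       (scal k (differential X s phi v)) = zero.

Definition principal_curvature (X : R -> R -> E3) (s phi k : R) : Prop :=
  exists v, principal_direction X s phi v k.

Definition max_principal_curvature (X : R -> R -> E3) (s phi k : R) : Prop :=
  principal_curvature X s phi k /\
  forall k', principal_curvature X s phi k' -> k' <= k.
Definition min_principal_curvature (X : R -> R -> E3) (s phi k : R) : Prop :=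
  principal_curvature X s phi k /\
  forall k', principal_curvature X s phi k' -> k <= k'.

Definition umbilic (X : R -> R -> E3) (s phi : R) : Prop :=
  exists k, max_principal_curvature X s phi k /\
            min_principal_curvature X s phi k.

(* A direction field is given by the nonzero vectors of its lines:
   D s phi v means that v is a nonzero vector of the line at (s, phi). *)
Definition direction_field : Type := R -> R -> R * R -> Prop.

Definition max_field (X : R -> R -> E3) : direction_field := fun s phi v =>
  exists k, max_principal_curvature X s phi k /\ principal_direction X s phi v k.
Definition min_field (X : R -> R -> E3) : direction_field := fun s phi v =>
  exists k, min_principal_curvature X s phi k /\ principal_direction X s phi v k.
(* For a nowhere vanishing V. *)
Definition span_field (V : R -> R -> R * R) : direction_field := fun s phi v =>
  exists l : R, l <> 0 /\ v = scal l (V s phi).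

(* An integral curve of D, up to regular reparametrization, on the open
   interval ]u0, u1[, which may be unbounded. *)
Definition integral_curve (D : direction_field) (u0 u1 : Rbar)
    (g : R -> R * R) : Prop :=
  forall u : R, Rbar_lt u0 u -> Rbar_lt u u1 ->
    exists v, is_derive g u v /\ D (fst (g u)) (snd (g u)) v.

(* complete_line D p q: q lies on the complete (maximally extended) integral
   curve of D through p. *)
Definition complete_line (D : direction_field) (p q : R * R) : Prop :=
  exists (u0 u1 : Rbar) (g : R -> R * R) (u v : R),
    integral_curve D u0 u1 g /\
    Rbar_lt u0 u /\ Rbar_lt u u1 /\ Rbar_lt u0 v /\ Rbar_lt v u1 /\
    g u = p /\ g v = q.

Definition is_circle (A : E3 -> Prop) : Prop :=
  exists (o nu : E3) (rho : R), 0 < rho /\ enorm nu = 1 /\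
    forall p, A p <-> enorm (minus p o) = rho /\ dot (minus p o) nu = 0.

Definition tube (c t n b : R -> E3) (r theta : R -> R) (s phi : R) : E3 :=
  plus (plus (c s) (scal (r s * cos (theta s)) (t s)))
       (scal (r s * sin (theta s))
             (plus (scal (cos phi) (n s)) (scal (sin phi) (b s)))).

(* Main.v *)
Require Import Defs.
From Stdlib Require Import Reals Lra FunctionalExtensionality.
From Coquelicot Require Import Coquelicot.
Open Scope R_scope.

(** The relation [cos theta = - r'] says that the circle [s = const] lies on
    the sphere of radius [r s] about [c s] in such a way that the surface is
    tangent to that sphere along it: [alpha = c + r m], where the unit radial
    field [m = - r' t + w (cos phi n + sin phi b)], [w = sqrt (1 - r'^2)], is
    normal to [alpha].  So [alpha] is a canal surface, the envelope of a
    one-parameter family of spheres, and its Gauss map is [N = - m].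

    Two unit fields, which with [N] form an orthonormal frame, diagonalise both
    differentials: [meridian] = [g] and [parallel] = [f].  In terms of
      [bend = kappa w cos phi + r''],
      [spread = r bend - w^2],
      [drift = tau + (r' / w) kappa sin phi]
    the Frenet equations give
      [alpha_s = - (spread / w) g + r w drift f],    [alpha_phi = r w f],
      [N_s = (bend / w) g - w drift f],              [N_phi = - w f].
    Hence [dN = - k dalpha] holds along [d/dphi] with [k = 1 / r] and along
    [d/ds - drift d/dphi] with [k = bend / spread] ([canal_maximal_direction],
    [canal_minimal_direction]).  The bound on [kappa] makes [spread] negative;
    this fixes the sign of the normal ([canal_normal]) and, because
    [1 / r - bend / spread = - w^2 / (r spread)], the order of the two
    curvatures ([canal_curvature_gap]).

    As [alpha] is an immersion, two principal directions that are linearly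
    independent determine every solution of Rodrigues' equation
    ([rodrigues_split]).  This identifies the two direction fields, and with
    them the curvatures, the integral curves and the absence of umbilics.  A
    line of the field [d/dphi] through [p] is the whole line [s = fst p] of
    the universal cover, whose image is the circle in which the surface
    touches the sphere. *)

(** * Linear algebra in an oriented orthonormal frame *)

Lemma E3_ext (p q : E3) :
  cx p = cx q -> cy p = cy q -> cz p = cz q -> p = q.
Proof.
destruct p as [[x y] z], q as [[x' y'] z']; cbn.
now intros -> -> ->.
Qed.

Ltac coords := unfold dot; cbn; unfold cx, cy, cz; cbn.
Ltac coord_ring := coords; ring.

Lemma enorm_unit (p : E3) : enorm p = 1 -> dot p p = 1.
Proof.
unfold enorm; intros H.
destruct (Rle_lt_dec 0 (dot p p)) as [h|h].
- rewrite <- (sqrt_sqrt _ h), H; ring.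
- rewrite sqrt_neg_0 in H; lra.
Qed.

Record oriented_frame (t n b : E3) : Prop := {
  frame_t : dot t t = 1;
  frame_n : dot n n = 1;
  frame_tn : dot t n = 0;
  frame_b : b = cross t n }.

Definition comb (t n b : E3) (x y z : R) : E3 :=
  plus (plus (scal x t) (scal y n)) (scal z b).

Lemma frame_nb (t n b : E3) : oriented_frame t n b -> cross n b = t.
Proof.
intros [Ht Hn Htn ->].
transitivity (plus (scal (dot n n) t) (scal (- dot t n) n)).
- apply E3_ext; coord_ring.
- rewrite Hn, Htn; apply E3_ext; coord_ring.
Qed.

Lemma frame_bt (t n b : E3) : oriented_frame t n b -> cross b t = n.
Proof.
intros [Ht Hn Htn ->].
transitivity (plus (scal (dot t t) n) (scal (- dot t n) t)).
- apply E3_ext; coord_ring.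
- rewrite Ht, Htn; apply E3_ext; coord_ring.
Qed.

Lemma cross_comb (t n b : E3) (x y z x' y' z' : R) :
  oriented_frame t n b ->
  cross (comb t n b x y z) (comb t n b x' y' z') =
  comb t n b (y * z' - z * y') (z * x' - x * z') (x * y' - y * x').
Proof.
intros H.
transitivity (comb (cross n b) (cross b t) (cross t n)
                (y * z' - z * y') (z * x' - x * z') (x * y' - y * x')).
- apply E3_ext; coord_ring.
- rewrite (frame_nb _ _ _ H), (frame_bt _ _ _ H), <- (frame_b _ _ _ H).
  reflexivity.
Qed.

Lemma dot_comb (t n b : E3) (x y z x' y' z' : R) :
  oriented_frame t n b ->
  dot (comb t n b x y z) (comb t n b x' y' z') = x * x' + y * y' + z * z'.
Proof.
intros [Ht Hn Htn ->].
transitivity (x * x' * dot t t + y * y' * dot n n + (x * y' + y * x') * dot t n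
   + z * z' * (dot t t * dot n n - dot t n ^ 2)).
- coord_ring.
- rewrite Ht, Hn, Htn; ring.
Qed.

(** Cramer's rule expresses [det (t, n, b) p] through the dot products of [p]
    with the frame and the cross products of the frame vectors; for an oriented
    frame the determinant is [1] and the cross products are the frame again. *)
Lemma comb_coordinates (t n b p : E3) :
  oriented_frame t n b -> p = comb t n b (dot p t) (dot p n) (dot p b).
Proof.
intros H.
assert (det : dot t (cross n b) = 1)
  by (rewrite (frame_nb _ _ _ H); apply H).
transitivity (comb (cross n b) (cross b t) (cross t n)
                (dot p t) (dot p n) (dot p b)).
- transitivity (scal (dot t (cross n b)) p).
  + rewrite det; apply E3_ext; coord_ring.
  + apply E3_ext; coord_ring.
- now rewrite (frame_nb _ _ _ H), (frame_bt _ _ _ H), <- (frame_b _ _ _ H).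
Qed.

(** * Differentiation along a moving frame *)

Lemma is_derive_fst {U V : NormedModule R_AbsRing} (g : R -> U * V)
    (u : R) (v : U * V) :
  is_derive g u v -> is_derive (fun x => fst (g x)) u (fst v).
Proof.
intros H; unfold is_derive; eapply filterdiff_ext_lin.
- apply (filterdiff_comp' g fst u _ fst H).
  apply filterdiff_linear, is_linear_fst.
- easy.
Qed.

Lemma is_derive_snd {U V : NormedModule R_AbsRing} (g : R -> U * V)
    (u : R) (v : U * V) :
  is_derive g u v -> is_derive (fun x => snd (g x)) u (snd v).
Proof.
intros H; unfold is_derive; eapply filterdiff_ext_lin.
- apply (filterdiff_comp' g snd u _ snd H).
  apply filterdiff_linear, is_linear_snd.
- easy.
Qed.

Lemma Derive3_unique (X : R -> E3) (u : R) (v : E3) :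
  is_derive X u v -> Derive3 X u = v.
Proof.
intros H.
apply E3_ext; apply is_derive_unique.
- exact (is_derive_fst _ _ _ (is_derive_fst _ _ _ H)).
- exact (is_derive_snd _ _ _ (is_derive_fst _ _ _ H)).
- exact (is_derive_snd _ _ _ H).
Qed.

Lemma is_derive_scal_fct (f : R -> R) (X : R -> E3) (u f' : R) (X' : E3) :
  is_derive f u f' -> is_derive X u X' ->
  is_derive (fun v => scal (f v) (X v)) u
    (plus (scal f' (X u)) (scal (f u) X')).
Proof.
intros Hf HX.
eapply filterdiff_ext_lin.
- apply (filterdiff_scal_fct u f X _ _ Rmult_comm Hf HX).
- intros y; apply E3_ext; coord_ring.
Qed.

Lemma is_derive_comb (t n b : R -> E3) (x y z : R -> R) (u : R)
    (t' n' b' : E3) (x' y' z' : R) :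
  is_derive t u t' -> is_derive n u n' -> is_derive b u b' ->
  is_derive x u x' -> is_derive y u y' -> is_derive z u z' ->
  is_derive (fun v => comb (t v) (n v) (b v) (x v) (y v) (z v)) u
    (plus (comb (t u) (n u) (b u) x' y' z')
          (comb t' n' b' (x u) (y u) (z u))).
Proof.
intros Ht Hn Hb Hx Hy Hz.
replace (plus _ _) with
  (plus (plus (plus (scal x' (t u)) (scal (x u) t'))
              (plus (scal y' (n u)) (scal (y u) n')))
        (plus (scal z' (b u)) (scal (z u) b')))
  by (apply E3_ext; coord_ring).
apply @is_derive_plus; [apply @is_derive_plus|]; now apply is_derive_scal_fct.
Qed.

Lemma frenet_oriented c t n b kappa tau (s : R) :
  frenet_frame c t n b kappa tau -> oriented_frame (t s) (n s) (b s).
Proof.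
intros H; split.
- apply enorm_unit, H.
- apply enorm_unit, H.
- apply H.
- apply H.
Qed.

(** The Frenet equations in coordinates: a vector field along the curve is
    differentiated by differentiating its coordinates and adding the
    skew-symmetric action of [kappa] and [tau] on them. *)
Lemma frenet_comb c t n b kappa tau (x y z : R -> R) (s x' y' z' : R) :
  frenet_frame c t n b kappa tau ->
  is_derive x s x' -> is_derive y s y' -> is_derive z s z' ->
  is_derive (fun v => comb (t v) (n v) (b v) (x v) (y v) (z v)) s
    (comb (t s) (n s) (b s) (x' - kappa s * y s)
       (y' + kappa s * x s - tau s * z s) (z' + tau s * y s)).
Proof.
intros H Hx Hy Hz.
replace (comb (t s) (n s) (b s) _ _ _) with
 (plus (comb (t s) (n s) (b s) x' y' z')
   (comb (scal (kappa s) (n s))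
     (plus (scal (- kappa s) (t s)) (scal (tau s) (b s)))
     (scal (- tau s) (n s)) (x s) (y s) (z s)))
 by (apply E3_ext; coord_ring).
exact (is_derive_comb t n b x y z s _ _ _ x' y' z'
  (frenet_dt _ _ _ _ _ _ H s) (frenet_dn _ _ _ _ _ _ H s)
  (frenet_db _ _ _ _ _ _ H s) Hx Hy Hz).
Qed.

(** * Principal directions from two independent ones *)

(** Writing [v = fst v (1, B) + (snd v - B fst v) (0, 1)], the left-hand side of
    Rodrigues' equation for [v] is the image under [dX] of the same combination
    with its terms multiplied by [k - k1] and [k - k2], and [dX] is
    injective. *)
Lemma rodrigues_split (X : R -> R -> E3) (s phi B k1 k2 k : R) (v : R * R) :
  immersion X ->
  principal_direction X s phi (1, B) k1 ->
  principal_direction X s phi (0, 1) k2 ->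
  principal_direction X s phi v k <->
  v <> zero /\ fst v * (k - k1) = 0 /\ (snd v - B * fst v) * (k - k2) = 0.
Proof.
intros HX [_ H1] [_ H2].
(* [u] is that scaled combination, in the frame [d/ds], [d/dphi]. *)
set (u := (fst v * (k - k1),
   (snd v - B * fst v) * (k - k2) + B * (fst v * (k - k1)))).
assert (E : plus (Defs.differential (unit_normal X) s phi v)
              (scal k (Defs.differential X s phi v)) = Defs.differential X s phi u).
{ unfold Defs.differential in *.
  revert H1 H2.
  generalize (d_s X s phi) (d_phi X s phi) (d_s (unit_normal X) s phi)
    (d_phi (unit_normal X) s phi); intros Xs Xp Ns Np H1 H2.
  assert (coord : forall xs xp np ns,
    1 * ns + B * np + k1 * (1 * xs + B * xp) = 0 ->
    0 * ns + 1 * np + k2 * (0 * xs + 1 * xp) = 0 ->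
    fst v * ns + snd v * np + k * (fst v * xs + snd v * xp) =
    fst u * xs + snd u * xp).
  { intros xs xp np ns h1 h2; unfold u; cbn [fst snd].
    replace np with (- k2 * xp) in * by lra.
    replace ns with (- B * (- k2 * xp) - k1 * (1 * xs + B * xp)) by lra.
    ring. }
  apply E3_ext;
    [ exact (coord (cx Xs) (cx Xp) _ _ (f_equal cx H1) (f_equal cx H2))
    | exact (coord (cy Xs) (cy Xp) _ _ (f_equal cy H1) (f_equal cy H2))
    | exact (coord (cz Xs) (cz Xp) _ _ (f_equal cz H1) (f_equal cz H2)) ]. }
unfold principal_direction; rewrite E.
split; intros [Hv H]; split; trivial.
- apply HX in H.
  assert (Ha : fst u = 0) by now rewrite H.
  assert (Hb : snd u = 0) by now rewrite H.
  unfold u in Ha, Hb; cbn [fst snd] in Ha, Hb.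
  rewrite Ha in Hb; split; [exact Ha | lra].
- destruct H as [Ha Hb].
  unfold u; rewrite Ha, Hb.
  apply E3_ext; coord_ring.
Qed.

Section TwoDirections.
Context (X : R -> R -> E3) (s phi B k1 k2 : R).
Hypothesis (immX : immersion X).
Hypothesis (dir1 : principal_direction X s phi (1, B) k1).
Hypothesis (dir2 : principal_direction X s phi (0, 1) k2).
Hypothesis (k12 : k1 < k2).

Lemma principal_curvature_iff (k : R) :
  principal_curvature X s phi k <-> k = k1 \/ k = k2.
Proof.
split.
- intros [v Hv].
  destruct (proj1 (rodrigues_split X s phi B k1 k2 k v immX dir1 dir2) Hv)
    as [v0 [Ha Hb]].
  destruct (Req_dec k k1) as [?|n1]; [now left|].
  destruct (Req_dec k k2) as [?|n2]; [now right|].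
  apply Rmult_integral in Ha; apply Rmult_integral in Hb.
  exfalso; apply v0.
  destruct Ha as [Ha|Ha]; [|lra]; destruct Hb as [Hb|Hb]; [|lra].
  rewrite Ha in Hb; apply injective_projections; cbn; lra.
- intros [->| ->]; [now exists (1, B) | now exists (0, 1)].
Qed.

Lemma max_principal_curvature_iff (k : R) :
  max_principal_curvature X s phi k <-> k = k2.
Proof.
unfold max_principal_curvature; setoid_rewrite principal_curvature_iff; split.
- intros [[->| ->] H]; [specialize (H k2 (or_intror eq_refl)); lra | easy].
- intros ->; split; [now right | intros k' [->| ->]; lra].
Qed.

Lemma min_principal_curvature_iff (k : R) :
  min_principal_curvature X s phi k <-> k = k1.
Proof.
unfold min_principal_curvature; setoid_rewrite principal_curvature_iff; split.
- intros [[->| ->] H]; [easy | specialize (H k1 (or_introl eq_refl)); lra].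
- intros ->; split; [now left | intros k' [->| ->]; lra].
Qed.

Lemma max_field_iff (v : R * R) :
  max_field X s phi v <-> exists l : R, l <> 0 /\ v = scal l (0, 1).
Proof.
unfold max_field; setoid_rewrite max_principal_curvature_iff.
setoid_rewrite (fun k => rodrigues_split X s phi B k1 k2 k v immX dir1 dir2).
split.
- intros [k [-> [v0 [Ha _]]]].
  assert (h : fst v = 0) by (apply Rmult_integral in Ha; lra).
  exists (snd v); split.
  + intros h'; apply v0; now apply injective_projections.
  + apply injective_projections; cbn; rewrite ?h; ring.
- intros [l [l0 ->]]; exists k2; split; [easy|split; [|split; cbn; ring]].
  intros h; apply l0; apply (f_equal snd) in h; cbn in h; lra.
Qed.

Lemma min_field_iff (v : R * R) :
  min_field X s phi v <-> exists l : R, l <> 0 /\ v = scal l (1, B).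
Proof.
unfold min_field; setoid_rewrite min_principal_curvature_iff.
setoid_rewrite (fun k => rodrigues_split X s phi B k1 k2 k v immX dir1 dir2).
split.
- intros [k [-> [v0 [_ Hb]]]].
  assert (h : snd v = B * fst v) by (apply Rmult_integral in Hb; lra).
  exists (fst v); split.
  + intros h'; apply v0; apply injective_projections; [easy|].
    rewrite h, h'; cbn; ring.
  + apply injective_projections; cbn; rewrite ?h; ring.
- intros [l [l0 ->]]; exists k1; split; [easy|split; [|split; cbn; ring]].
  intros h; apply l0; apply (f_equal fst) in h; cbn in h; lra.
Qed.

Lemma not_umbilic : ~ umbilic X s phi.
Proof.
intros [k [Hmax Hmin]].
apply max_principal_curvature_iff in Hmax.
apply min_principal_curvature_iff in Hmin.
lra.
Qed.
End TwoDirections.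

(** * Integral curves *)

Lemma integral_curve_ext (D D' : direction_field) (u0 u1 : Rbar)
    (g : R -> R * R) :
  (forall s phi v, D s phi v <-> D' s phi v) ->
  integral_curve D u0 u1 g <-> integral_curve D' u0 u1 g.
Proof. unfold integral_curve; intros H; now setoid_rewrite H. Qed.

Lemma complete_line_ext (D D' : direction_field) (p q : R * R) :
  (forall s phi v, D s phi v <-> D' s phi v) ->
  complete_line D p q <-> complete_line D' p q.
Proof.
unfold complete_line; intros H.
now setoid_rewrite (fun u0 u1 g => integral_curve_ext D D' u0 u1 g H).
Qed.

Lemma Rbar_lt_between (u0 u1 : Rbar) (u v x : R) :
  Rbar_lt u0 u -> Rbar_lt v u1 -> u <= x <= v ->
  Rbar_lt u0 x /\ Rbar_lt x u1.
Proof. destruct u0, u1; cbn; intuition lra. Qed.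

Lemma is_derive_vertical (a u : R) :
  is_derive (fun x => (a, x) : R * R) u (0, 1).
Proof.
apply is_derive_ext with (fun x => plus (a, 0) (scal x (0, 1)) : R * R).
{ intros x; apply injective_projections; cbn; ring. }
assert (H : is_derive (fun x => scal x (0, 1) : R * R) u (0, 1))
  by (apply filterdiff_linear, is_linear_scal_l).
pose proof (is_derive_plus (fun _ => (a, 0) : R * R) _ u _ _
  (is_derive_const _ u) H) as H'.
now rewrite plus_zero_l in H'.
Qed.

(** Along an integral curve the first coordinate has zero derivative; conversely
    one curve defined on all of [R] sweeps the whole vertical line. *)
Lemma complete_line_vertical (p q : R * R) :
  complete_line (span_field (fun _ _ => (0, 1))) p q <-> fst q = fst p.
Proof.
split.
- intros (u0 & u1 & g & u & v & Hg & Hu0 & Hu1 & Hv0 & Hv1 & <- & <-).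
  assert (const : forall a b : R, Rbar_lt u0 a -> Rbar_lt b u1 -> a < b ->
    fst (g a) = fst (g b)).
  { intros a b' Ha Hb ab.
    apply (eq_is_derive (fun x => fst (g x)) a b'); [|exact ab].
    intros x Hx.
    destruct (Rbar_lt_between u0 u1 a b' x Ha Hb Hx) as [h0 h1].
    destruct (Hg x h0 h1) as [v' [Hd [l [_ ->]]]].
    replace (zero : R_NormedModule) with (fst (scal l (0, 1) : R * R))
      by (cbn; ring).
    exact (is_derive_fst g x _ Hd). }
  destruct (Rtotal_order u v) as [h|[->|h]]; [|easy|].
  + symmetry; now apply const.
  + now apply const.
- intros H.
  exists m_infty, p_infty, (fun u => (fst p, u)), (snd p), (snd q).
  repeat split; trivial.
  + intros u _ _; exists (0, 1); split.
    * apply is_derive_vertical.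
    * exists 1; split; [lra|].
      apply injective_projections; cbn; ring.
  + now destruct p.
  + rewrite <- H; now destruct q.
Qed.

(** * Circles *)

Lemma unit_circle_angle (x y : R) :
  x ^ 2 + y ^ 2 = 1 -> exists phi, cos phi = x /\ sin phi = y.
Proof.
intros H.
assert (hx : -1 <= x <= 1) by nra.
assert (hs : sin (acos x) = Rabs y).
{ rewrite sin_acos by exact hx.
  replace (1 - x²) with (y²) by (unfold Rsqr; lra).
  apply sqrt_Rsqr_abs. }
destruct (Rle_lt_dec 0 y) as [hy|hy].
- exists (acos x); rewrite cos_acos by exact hx.
  rewrite hs, Rabs_pos_eq by exact hy; easy.
- exists (- acos x); rewrite cos_neg, sin_neg, cos_acos by exact hx.
  rewrite hs, Rabs_left by exact hy; split; ring.
Qed.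

Lemma frame_circle (t n b o : E3) (rho : R) :
  oriented_frame t n b -> 0 < rho ->
  is_circle (fun p => exists phi,
    p = plus o (comb t n b 0 (rho * cos phi) (rho * sin phi))).
Proof.
intros H hrho.
exists o, t, rho; split; [exact hrho|split].
{ unfold enorm; rewrite (frame_t _ _ _ H); apply sqrt_1. }
assert (Ht : t = comb t n b 1 0 0) by (apply E3_ext; coord_ring).
intros p; split.
- intros [phi ->].
  replace (minus _ o) with (comb t n b 0 (rho * cos phi) (rho * sin phi))
    by (apply E3_ext; coord_ring).
  split.
  + unfold enorm; rewrite dot_comb by exact H.
    replace (_ + _) with (rho ^ 2 * (Rsqr (sin phi) + Rsqr (cos phi)))
      by (unfold Rsqr; ring).
    rewrite sin2_cos2, Rmult_1_r; apply sqrt_pow2; lra.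
  + rewrite Ht at 2; rewrite dot_comb by exact H; ring.
- intros [Hn Hd].
  pose proof (comb_coordinates t n b (minus p o) H) as E.
  rewrite Hd in E.
  set (y := dot (minus p o) n) in E; set (z := dot (minus p o) b) in E.
  assert (Hyz : y ^ 2 + z ^ 2 = rho ^ 2).
  { unfold enorm in Hn; rewrite E, dot_comb in Hn by exact H.
    rewrite <- Hn, pow2_sqrt by nra; ring. }
  destruct (unit_circle_angle (y / rho) (z / rho)) as [phi [Hc Hs]].
  { transitivity ((y ^ 2 + z ^ 2) / rho ^ 2); [field; lra|].
    rewrite Hyz; field; lra. }
  exists phi; rewrite Hc, Hs.
  replace (rho * (y / rho)) with y by (field; lra).
  replace (rho * (z / rho)) with z by (field; lra).
  rewrite <- E; apply E3_ext; coord_ring.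
Qed.

(** * Canal surfaces *)

(** The envelope of the spheres of radius [r s] about [c s]. The functions [r1],
    [r2] are the first two derivatives of [r], and [w] is [sqrt (1 - r1^2)]; its
    derivative comes from [w^2 + r1^2 = 1]. *)
Section CanalSurface.
Context (c t n b : R -> E3) (kappa tau r r1 r2 w : R -> R).
Hypothesis (frenet : frenet_frame c t n b kappa tau).
Hypothesis (dr : forall s, is_derive r s (r1 s)).
Hypothesis (dr1 : forall s, is_derive r1 s (r2 s)).
Hypothesis (dw : forall s, is_derive w s (- (r1 s * r2 s / w s))).
Hypothesis (w_pos : forall s, 0 < w s).
Hypothesis (w_sq : forall s, w s ^ 2 = 1 - r1 s ^ 2).
Hypothesis (r_pos : forall s, 0 < r s).

(** The outward unit normal of the sphere about [c s] at its points of contact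
    with the envelope. *)
Definition ray (s phi : R) : E3 :=
  comb (t s) (n s) (b s) (- r1 s) (w s * cos phi) (w s * sin phi).
Definition canal (s phi : R) : E3 := plus (c s) (scal (r s) (ray s phi)).

Definition bend (s phi : R) : R := kappa s * w s * cos phi + r2 s.
Definition spread (s phi : R) : R :=
  r s * w s * kappa s * cos phi + r s * r2 s - (1 - r1 s ^ 2).
Definition drift (s phi : R) : R :=
  tau s + r1 s / w s * kappa s * sin phi.
Hypothesis (spread_neg : forall s phi, spread s phi < 0).

(** [meridian], [parallel] and [- ray] form an oriented orthonormal frame. The
    circle of contact is tangent to [parallel], and the part of the s-derivative
    of [canal] orthogonal to it is [- spread / w] times [meridian]. *)
Definition meridian (s phi : R) : E3 :=
  comb (t s) (n s) (b s) (w s) (r1 s * cos phi) (r1 s * sin phi).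
Definition parallel (s phi : R) : E3 :=
  comb (t s) (n s) (b s) 0 (- sin phi) (cos phi).

Lemma w_neq s : w s <> 0.
Proof. generalize (w_pos s); lra. Qed.

Lemma cos_sq (phi : R) : cos phi ^ 2 = 1 - sin phi ^ 2.
Proof. generalize (sin2_cos2 phi); unfold Rsqr; lra. Qed.

(** By the Frenet equations the coordinates of [ray_s] are [- bend] along [t]
    and [- (r1 / w) bend] along [cos phi n + sin phi b]: both are [- bend / w]
    times those of the meridian, so that only the meridian and the parallel
    occur. *)
Lemma is_derive_ray_s (s phi : R) :
  is_derive (fun u => ray u phi) s
    (plus (scal (- (bend s phi / w s)) (meridian s phi))
          (scal (w s * drift s phi) (parallel s phi))).
Proof.
assert (Hx : is_derive (fun u => - r1 u) s (- r2 s))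
  by (apply @is_derive_opp, dr1).
assert (Hw : forall a, is_derive (fun u => w u * a) s
    (- (r1 s * r2 s / w s) * a)).
{ intros a; apply is_derive_ext with (fun u => scal (w u) a); [easy|].
  apply @is_derive_scal_l, dw. }
replace (plus _ _) with (comb (t s) (n s) (b s)
  (- r2 s - kappa s * (w s * cos phi))
  (- (r1 s * r2 s / w s) * cos phi + kappa s * - r1 s
     - tau s * (w s * sin phi))
  (- (r1 s * r2 s / w s) * sin phi + tau s * (w s * cos phi))).
- exact (frenet_comb c t n b kappa tau _ _ _ s _ _ _ frenet Hx
    (Hw (cos phi)) (Hw (sin phi))).
- pose proof (cos_sq phi) as hc; pose proof (w_neq s).
  transitivity (comb (t s) (n s) (b s) (- bend s phi)
    (- (bend s phi / w s) * (r1 s * cos phi) - w s * drift s phi * sin phi)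
    (- (bend s phi / w s) * (r1 s * sin phi) + w s * drift s phi * cos phi)).
  + unfold bend, drift; f_equal.
    * ring.
    * field_simplify; trivial; rewrite ?hc; field; trivial.
    * field; trivial.
  + apply E3_ext; coords; field; trivial.
Qed.

Lemma is_derive_ray_phi (s phi : R) :
  is_derive (ray s) phi (scal (w s) (parallel s phi)).
Proof.
replace (scal (w s) (parallel s phi)) with
  (plus (comb (t s) (n s) (b s) 0 (w s * - sin phi) (w s * cos phi))
        (comb zero zero zero (- r1 s) (w s * cos phi) (w s * sin phi)))
  by (apply E3_ext; coord_ring).
apply (is_derive_comb (fun _ => t s) (fun _ => n s) (fun _ => b s)
  (fun _ => - r1 s) (fun u => w s * cos u) (fun u => w s * sin u)).
1-4: apply @is_derive_const.
- apply is_derive_scal, is_derive_cos.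
- apply is_derive_scal, is_derive_sin.
Qed.

(** The s-derivative is [t + r1 ray + r ray_s], where
    [t + r1 ray = w meridian] because [1 - r1^2 = w^2]; its meridian component is therefore
    [w - r bend / w = - spread / w]. *)
Lemma canal_d_s (s phi : R) :
  d_s canal s phi =
  plus (scal (- (spread s phi / w s)) (meridian s phi))
       (scal (r s * w s * drift s phi) (parallel s phi)).
Proof.
apply Derive3_unique.
replace (plus _ _) with (plus (t s) (plus (scal (r1 s) (ray s phi))
   (scal (r s) (plus (scal (- (bend s phi / w s)) (meridian s phi))
          (scal (w s * drift s phi) (parallel s phi)))))).
- apply @is_derive_plus; [apply (frenet_velocity _ _ _ _ _ _ frenet)|].
  exact (is_derive_scal_fct r (fun u => ray u phi) s _ _ (dr s)
    (is_derive_ray_s s phi)).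
- unfold spread; rewrite <- w_sq.
  (* [t] is given coordinates homogeneous of degree two in [w], [r1], so that
     the identity to check is one of rational functions in free variables. *)
  assert (h : t s = comb (t s) (n s) (b s) (w s ^ 2 + r1 s ^ 2) 0 0)
    by (rewrite w_sq; apply E3_ext; coord_ring).
  pose proof (w_neq s).
  transitivity (plus (comb (t s) (n s) (b s) (w s ^ 2 + r1 s ^ 2) 0 0)
    (plus (scal (r1 s) (ray s phi))
       (scal (r s) (plus (scal (- (bend s phi / w s)) (meridian s phi))
          (scal (w s * drift s phi) (parallel s phi)))))).
  { now rewrite <- h. }
  unfold bend.
  apply E3_ext; coords; field; trivial.
Qed.

Lemma canal_d_phi (s phi : R) :
  d_phi canal s phi = scal (r s * w s) (parallel s phi).
Proof.
apply Derive3_unique.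
replace (scal (r s * w s) (parallel s phi)) with
  (plus zero (plus (scal 0 (ray s phi))
     (scal (r s) (scal (w s) (parallel s phi)))))
  by (apply E3_ext; coord_ring).
apply @is_derive_plus; [apply @is_derive_const|].
exact (is_derive_scal_fct (fun _ => r s) (ray s) phi _ _
  (is_derive_const (r s) phi) (is_derive_ray_phi s phi)).
Qed.

(** The cross product of the two partial derivatives is [(spread r) ray], which
    points inward because [spread] is negative. *)
Lemma canal_normal : unit_normal canal = fun s phi => opp (ray s phi).
Proof.
apply functional_extensionality; intros s.
apply functional_extensionality; intros phi.
pose proof (frenet_oriented _ _ _ _ _ _ s frenet) as F.
unfold unit_normal; rewrite canal_d_s, canal_d_phi.
pose proof (w_neq s) as w0; pose proof (cos_sq phi) as hc.
pose proof (spread_neg s phi) as hD.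
assert (hr := r_pos s).
assert (E : cross (plus (scal (- (spread s phi / w s)) (meridian s phi))
       (scal (r s * w s * drift s phi) (parallel s phi)))
   (scal (r s * w s) (parallel s phi)) =
  scal (spread s phi * r s) (ray s phi)).
{ transitivity (scal (- (spread s phi * r s))
    (cross (meridian s phi) (parallel s phi))).
  - apply E3_ext; coords; field; trivial.
  - unfold meridian, parallel, ray; rewrite cross_comb by exact F.
    replace (r1 s * cos phi * cos phi - r1 s * sin phi * - sin phi) with (r1 s)
      by (ring_simplify; rewrite hc; ring).
    apply E3_ext; coord_ring. }
rewrite E.
assert (En : enorm (scal (spread s phi * r s) (ray s phi)) =
    - (spread s phi * r s)).
{ unfold enorm.
  replace (dot _ _) with ((- (spread s phi * r s)) ^ 2 * dot (ray s phi) (ray s phi))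
    by coord_ring.
  unfold ray; rewrite dot_comb by exact F.
  replace (_ + _ + _) with (r1 s ^ 2 + w s ^ 2 * (cos phi ^ 2 + sin phi ^ 2)) by ring.
  rewrite hc, w_sq.
  replace (_ * _) with ((- (spread s phi * r s)) ^ 2) by ring.
  apply sqrt_pow2; nra. }
rewrite En.
apply E3_ext; coords; field; split; trivial; lra.
Qed.

(** Moving along [(1, - drift)] cancels the parallel components of both
    differentials, leaving [- spread / w] and [bend / w] on the meridian. *)
Lemma canal_minimal_direction (s phi : R) :
  principal_direction canal s phi (1, - drift s phi)
    (bend s phi / spread s phi).
Proof.
split; [intros h; apply (f_equal fst) in h; cbn in h; lra|].
unfold Defs.differential; rewrite canal_d_s, canal_d_phi, canal_normal.
replace (d_s (fun s phi => opp (ray s phi)) s phi) with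
 (opp (plus (scal (- (bend s phi / w s)) (meridian s phi))
          (scal (w s * drift s phi) (parallel s phi))))
 by (symmetry; apply Derive3_unique, @is_derive_opp, is_derive_ray_s).
replace (d_phi (fun s phi => opp (ray s phi)) s phi) with
 (opp (scal (w s) (parallel s phi)))
 by (symmetry; apply Derive3_unique, @is_derive_opp, is_derive_ray_phi).
pose proof (w_neq s); pose proof (spread_neg s phi).
apply E3_ext; coords; field; split; trivial; lra.
Qed.

Lemma canal_maximal_direction (s phi : R) :
  principal_direction canal s phi (0, 1) (1 / r s).
Proof.
split; [intros h; apply (f_equal snd) in h; cbn in h; lra|].
unfold Defs.differential; rewrite canal_d_s, canal_d_phi, canal_normal.
replace (d_phi (fun s phi => opp (ray s phi)) s phi) with
 (opp (scal (w s) (parallel s phi)))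
 by (symmetry; apply Derive3_unique, @is_derive_opp, is_derive_ray_phi).
pose proof (r_pos s); pose proof (w_neq s).
apply E3_ext; coords; field; split; trivial; lra.
Qed.

(** [spread = r bend - w^2] gives
    [1 / r - bend / spread = - w^2 / (r spread)]. *)
Lemma canal_curvature_gap (s phi : R) : bend s phi / spread s phi < 1 / r s.
Proof.
pose proof (r_pos s) as hr; pose proof (spread_neg s phi) as hD.
assert (E : 1 / r s - bend s phi / spread s phi =
  w s ^ 2 * / (r s * - spread s phi)).
{ rewrite w_sq; unfold spread, bend in *; field; split; lra. }
assert (0 < w s ^ 2 * / (r s * - spread s phi)); [|lra].
apply Rmult_lt_0_compat; [apply pow_lt, w_pos|].
apply Rinv_0_lt_compat, Rmult_lt_0_compat; lra.
Qed.

(** The circle of contact lies in the plane orthogonal to [t] at signed distance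
    [- r r1] from [c s] along [t]; its radius is [r w]. *)
Lemma canal_circle (s : R) :
  is_circle (fun x => exists phi, x = canal s phi).
Proof.
pose proof (frame_circle (t s) (n s) (b s)
  (plus (c s) (scal (- (r s * r1 s)) (t s))) (r s * w s)
  (frenet_oriented _ _ _ _ _ _ s frenet)
  (Rmult_lt_0_compat _ _ (r_pos s) (w_pos s))) as H.
destruct H as (o & nu & rho & h1 & h2 & H).
exists o, nu, rho; split; [exact h1|split; [exact h2|]].
intros p; rewrite <- H; clear H.
split; intros [phi ->]; exists phi; apply E3_ext; coord_ring.
Qed.

End CanalSurface.

(** * The tube as a canal surface *)

(** Since [theta] lies in [(0, PI)], [sin theta] is the positive root [w]. *)
Lemma tube_canal (c t n b : R -> E3) (r theta : R -> R) :
  (forall s, 0 < theta s < PI) -> (forall s, cos (theta s) = - Derive r s) ->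
  tube c t n b r theta =
  canal c t n b r (Derive r) (fun s => sqrt (1 - Derive r s ^ 2)).
Proof.
intros htheta hcos.
apply functional_extensionality; intros s.
apply functional_extensionality; intros phi.
assert (hsin : sin (theta s) = sqrt (1 - Derive r s ^ 2)).
{ rewrite <- (sqrt_Rsqr (sin (theta s)))
    by (apply Rlt_le, sin_gt_0; apply htheta).
  f_equal; rewrite sin2, hcos; unfold Rsqr; ring. }
unfold tube; rewrite hcos, hsin.
apply E3_ext; coord_ring.
Qed.

Lemma is_derive_sqrt_one_minus_sq (f : R -> R) (s f' : R) :
  is_derive f s f' -> f s ^ 2 < 1 ->
  is_derive (fun u => sqrt (1 - f u ^ 2)) s
    (- (f s * f' / sqrt (1 - f s ^ 2))).
Proof.
intros Hf H1.
assert (h0 : sqrt (1 - f s ^ 2) <> 0)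
  by (apply Rgt_not_eq, sqrt_lt_R0; lra).
auto_derive.
- split; [now exists f'|split; [cbn in *; lra|easy]].
- change (Derive (fun x => f x) s) with (Derive f s).
  rewrite (is_derive_unique _ _ _ Hf).
  replace (f s * (f s * 1)) with (f s ^ 2) by ring.
  replace (1 + - f s ^ 2) with (1 - f s ^ 2) by ring.
  field; trivial.
Qed.

Theorem theorem4 (L : R) (c t n b : R -> E3) (kappa tau r theta : R -> R)
  (hL : 0 < L)
  (hc_smooth : smooth3 c) (hc_closed : periodic L c)
  (hfrenet : frenet_frame c t n b kappa tau)
  (hbiregular : forall s, 0 < kappa s)
  (hr_smooth : smooth r) (hr_per : periodic L r) (hr_pos : forall s, 0 < r s)
  (htheta_smooth : smooth theta) (htheta_per : periodic L theta)
  (htheta : forall s, 0 < theta s < PI)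
  (himm : immersion (tube c t n b r theta))
  (hcos : forall s, cos (theta s) = - Derive r s)
  (hr1 : forall s, Derive r s < 1)
  (hkappa : forall s,
     kappa s < (1 - Derive r s ^ 2 - r s * Derive_n r 2 s)
               / (r s * sqrt (1 - Derive r s ^ 2)))
  (hkappa2 : forall s,
     kappa s < Rabs ((1 - Derive r s ^ 2 - 2 * r s * Derive_n r 2 s)
                     / (2 * r s * sqrt (1 - Derive r s ^ 2)))) :
  let alpha := tube c t n b r theta in
  let w := fun s => sqrt (1 - Derive r s ^ 2) in
  let k2 := fun s => 1 / r s in
  let den := fun s phi =>
    r s * w s * kappa s * cos phi + r s * Derive_n r 2 s
    - (1 - Derive r s ^ 2) in
  let k1 := fun s phi =>
    (kappa s * w s * cos phi + Derive_n r 2 s) / den s phi in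
  let V := fun s phi =>
    (1, - (tau s + Derive r s / w s * kappa s * sin phi)) in
  (* (1) *)
  ((forall u0 u1 g,
      integral_curve (max_field alpha) u0 u1 g <->
      integral_curve (span_field (fun _ _ => (0, 1))) u0 u1 g) /\
   (forall p q, complete_line (max_field alpha) p q <-> fst q = fst p) /\
   (forall p, is_circle (fun x => exists q,
      complete_line (max_field alpha) p q /\ x = alpha (fst q) (snd q))) /\
   (forall s phi, max_principal_curvature alpha s phi (k2 s))) /\
  (* (2) *)
  (forall u0 u1 g,
     integral_curve (min_field alpha) u0 u1 g <->
     integral_curve (span_field V) u0 u1 g) /\
  (* (3) *)
  (forall s phi,
     den s phi < 0 /\ min_principal_curvature alpha s phi (k1 s phi)) /\
  (* (4) *)
  (forall s phi, ~ umbilic alpha s phi /\ k1 s phi < k2 s).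
Proof.
intros alpha w k2 den k1 V.
assert (hsq : forall s, Derive r s ^ 2 < 1).
{ intros s.
  assert (hs : 0 < sin (theta s)) by (apply sin_gt_0; apply htheta).
  generalize (sin2_cos2 (theta s)); rewrite hcos; unfold Rsqr; nra. }
assert (w_pos : forall s, 0 < w s)
  by (intros s; apply sqrt_lt_R0; generalize (hsq s); lra).
assert (w_sq : forall s, w s ^ 2 = 1 - Derive r s ^ 2)
  by (intros s; apply pow2_sqrt; generalize (hsq s); lra).
assert (dr : forall s, is_derive r s (Derive r s))
  by (intros s; apply Derive_correct, (hr_smooth 1%nat s)).
assert (dr1 : forall s, is_derive (Derive r) s (Derive_n r 2 s))
  by (intros s; apply Derive_correct, (hr_smooth 2%nat s)).
assert (dw : forall s,
    is_derive w s (- (Derive r s * Derive_n r 2 s / w s)))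
  by (intros s; apply is_derive_sqrt_one_minus_sq; [apply dr1 | apply hsq]).
assert (den_neg : forall s phi, den s phi < 0).
{ intros s phi.
  assert (h : kappa s * (r s * w s) <
      1 - Derive r s ^ 2 - r s * Derive_n r 2 s).
  { apply Rlt_div_r; [|exact (hkappa s)].
    apply Rmult_lt_0_compat; [apply hr_pos | apply w_pos]. }
  assert (h' : 0 < kappa s * (r s * w s))
    by (repeat apply Rmult_lt_0_compat; [apply hbiregular|apply hr_pos|apply w_pos]).
  unfold den; generalize (COS_bound phi); nra. }
assert (alphaE : alpha = canal c t n b r (Derive r) w)
  by (apply tube_canal; assumption).
assert (min_dir : forall s phi,
    principal_direction alpha s phi (V s phi) (k1 s phi)).
{ intros s phi; rewrite alphaE.
  now apply (canal_minimal_direction c t n b kappa tau r (Derive r) (Derive_n r 2) w). }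
assert (max_dir : forall s phi, principal_direction alpha s phi (0, 1) (k2 s)).
{ intros s phi; rewrite alphaE.
  now apply (canal_maximal_direction c t n b kappa tau r (Derive r) (Derive_n r 2) w). }
assert (gap : forall s phi, k1 s phi < k2 s).
{ intros s phi.
  now apply (canal_curvature_gap kappa r (Derive r) (Derive_n r 2) w). }
assert (max_fieldE : forall s phi v,
  max_field alpha s phi v <-> span_field (fun _ _ => (0, 1)) s phi v).
{ intros s phi v.
  exact (max_field_iff _ _ _ _ _ _ himm (min_dir s phi) (max_dir s phi) (gap s phi) v). }
assert (lines : forall p q, complete_line (max_field alpha) p q <-> fst q = fst p).
{ intros p q; rewrite (complete_line_ext _ _ p q max_fieldE).
  apply complete_line_vertical. }
split; [split; [|split; [exact lines|split]]|split; [|split]].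
- intros u0 u1 g; now apply integral_curve_ext.
- intros p.
  pose proof (canal_circle c t n b kappa tau r (Derive r) w hfrenet w_pos hr_pos (fst p))
    as (o & nu & rho & h1 & h2 & H).
  exists o, nu, rho; split; [exact h1|split; [exact h2|]].
  intros x; rewrite <- H; clear H.
  setoid_rewrite lines; split.
  + intros [q [hq ->]]; exists (snd q); now rewrite hq, alphaE.
  + intros [phi ->]; exists (fst p, phi); now rewrite alphaE.
- intros s phi.
  now apply (max_principal_curvature_iff _ _ _ _ _ _ himm (min_dir s phi) (max_dir s phi) (gap s phi)).
- intros u0 u1 g; apply integral_curve_ext; intros s phi v.
  exact (min_field_iff _ _ _ _ _ _ himm (min_dir s phi) (max_dir s phi) (gap s phi) v).
- intros s phi; split; [apply den_neg|].
  now apply (min_principal_curvature_iff _ _ _ _ _ _ himm (min_dir s phi) (max_dir s phi) (gap s phi)).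
- intros s phi; split; [|apply gap].
  exact (not_umbilic _ _ _ _ _ _ himm (min_dir s phi) (max_dir s phi) (gap s phi)).
Qed.
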